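(* Let $m,p\ge1$ be integers and let $\phi_1,\dots,\phi_m\in\Lambda^p(\mathbf{R}^{mp})^*$. Then $$|\phi_1\wedge\cdots\wedge\phi_m|^*\le C_{mp,p}^2\,C_{(m-1)p,p}^2\cdots C_{2p,p}^2\;\Vert\phi_1\Vert^*\cdots\Vert\phi_m\Vert^* ,$$ where the product of constants is $\prod_{j=2}^{m}C_{jp,p}^2$ (equal to $1$ if $m=1$).
   Context: Let $\Lambda^p(\mathbf{R}^n)$ be the space of $p$-vectors in $\mathbf{R}^n$ with its standard Euclidean norm $|\cdot|$ (for an orthonormal basis $e_1,\dots,e_n$ of $\mathbf{R}^n$, the $p$-vectors $e_{i_1}\wedge\cdots\wedge e_{i_p}$, $i_1<\cdots<i_p$, are orthonormal), and let $\Lambda^p(\mathbf{R}^n)^*$ be its dual space, the space of $p$-covectors, with the dual Euclidean norm $|\cdot|^*$ and with the wedge product normalized so that the $e_{i_1}^*\wedge\cdots\wedge e_{i_p}^*$ are orthonormal and form the basis dual to the $e_{i_1}\wedge\cdots\wedge e_{i_p}$. A $p$-vector is simple if it is a wedge product of $p$ vectors. The comass of $\phi\in\Lambda^p(\mathbf{R}^n)^*$ is $$\Vert\phi\Vert^*=\sup\{\phi(\xi):\xi\in\Lambda^p(\mathbf{R}^n)\text{ simple},\ |\xi|\le 1\}.$$ Define $$C_{n,p}=\sup\left\{\frac{|\phi|^*}{\Vert\phi\Vert^*}:\phi\in\Lambda^p(\mathbf{R}^n)^*,\ \phi\ne0\right\}.$$ *)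

(* Defs.v *)
From mathcomp Require Import all_boot all_order all_algebra.
From mathcomp Require Import all_classical all_reals.

Set Implicit Arguments.
Unset Strict Implicit.
Unset Printing Implicit Defensive.
Import Order.TTheory GRing.Theory Num.Theory.
Local Open Scope ring_scope.

(* The exterior algebra of R^n in coordinates: [x I] is the coefficient of
   e_{i_1} /\ ... /\ e_{i_p}, where I = {i_1 < ... < i_p}.  The same type serves
   for covectors, in the dual basis: [phi I] is then the coefficient of
   e_{i_1}^* /\ ... /\ e_{i_p}^*, i.e. the value of phi on
   e_{i_1} /\ ... /\ e_{i_p}. *)
Notation ext R n := {ffun {set 'I_n} -> R^o}.

Section Exterior.
Variables (R : realType) (n : nat).
Implicit Types (I J K : {set 'I_n}) (x y phi xi : ext R n).

Definition ext_basis I : ext R n := [ffun K : {set 'I_n} => (K == I)%:R].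

Definition vec (v : 'rV[R]_n) : ext R n :=
  \sum_(i < n) v 0 i *: ext_basis [set i].

(* e_I /\ e_J = (-1) ^ (inversions I J) e_{I u J} for disjoint I and J. *)
Definition inversions I J : nat :=
  #|[set ij : 'I_n * 'I_n | [&& ij.1 \in I, ij.2 \in J & (ij.2 < ij.1)%N]]|.

Definition wedge x y : ext R n :=
  [ffun K : {set 'I_n} => \sum_(I : {set 'I_n} | I \subset K)
     (-1) ^+ inversions I (K :\: I) * x I * y (K :\: I)].

(* x_1 /\ ... /\ x_m; the unit of the wedge product is e_{set0}. *)
Definition wedges (m : nat) (x : 'I_m -> ext R n) : ext R n :=
  \big[wedge/ext_basis finset.set0]_(i < m) x i.

Local Open Scope classical_set_scope.

(* The homogeneous component of degree p: Lambda^p(R^n), or its dual. *)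
Definition Lambda (p : nat) : set (ext R n) :=
  [set x : ext R n | forall I, #|I| != p -> x I = 0].

Definition simple (p : nat) : set (ext R n) :=
  [set xi : ext R n | exists v : 'I_p -> 'rV[R]_n, xi = wedges (fun i => vec (v i))].

(* The Euclidean norm: |.| on vectors, |.|^* on covectors. *)
Definition enorm x : R := Num.sqrt (\sum_(I : {set 'I_n}) x I ^+ 2).

(* The value phi(xi) of a covector on a vector. *)
Definition pairing phi xi : R := \sum_(I : {set 'I_n}) phi I * xi I.

Definition comass (p : nat) phi : R :=
  sup [set pairing phi xi | xi in [set xi : ext R n | simple p xi /\ enorm xi <= 1]].

End Exterior.

Local Open Scope classical_set_scope.

(* For 1 <= p <= n this set is nonempty and bounded above, so that the
   real-valued [sup], which is 0 otherwise, is the actual supremum; the set in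
   [comass] is always nonempty and bounded above. *)
Definition Ccst (R : realType) (n p : nat) : R :=
  sup [set enorm phi / comass p phi |
       phi in [set phi : ext R n | Lambda p phi /\ phi != 0]].

(* Main.v *)
Require Import Defs.
From HB Require Import structures.
From mathcomp Require Import all_boot all_order all_algebra.
From mathcomp Require Import reals ring.
Set Implicit Arguments.
Unset Strict Implicit.
Unset Printing Implicit Defensive.
Import Order.TTheory GRing.Theory Num.Theory.
Local Open Scope ring_scope.

(** The proof is an induction on the number m of factors, with two losses of a
    constant C = C_{mp,p} per step.  Write phi_1 /\ ... /\ phi_m =
    phi_1 /\ psi, where psi has degree r = (m-1)p in dimension n = p + r.
    This is a top form, so its norm is the absolute value of its only
    coefficient, which is the inner product of phi_1 with the Hodge dual *psi,
    a p-covector.  Cauchy-Schwarz and the definition of C, used once for phi_1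
    and once for *psi, bound it by C^2 ||phi_1|| ||*psi||, in comasses.

    Next, ||*psi|| <= ||psi|| ([comass_hodge]): evaluating *psi on the wedge of
    an orthonormal p-frame is, up to sign, evaluating psi on the wedge of an
    orthonormal frame of the orthogonal complement.

    Finally, ||psi|| is the supremum of psi over wedges of orthonormal r-frames
    ([simple_orthonormal], a Gram-Schmidt argument); on such a frame psi is the
    top coefficient of its restriction to the r-dimensional span, and this
    restriction is the wedge of the restrictions of phi_2, ..., phi_m.  The
    comass does not increase under restriction, so the induction hypothesis in
    dimension r applies ([comass_wedges_le]).

    Two tools carry the linear algebra without determinants.  A matrix A
    induces a homomorphism of exterior algebras ([induced]), compatible with
    products of matrices, and whose adjoint is induced by the transpose of A
    ([pairing_induced]); restriction to a subspace is the case where A is the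
    transpose of an orthonormal frame.  Contraction by a vector ([contract])
    is the adjoint of exterior multiplication by it, and is an antiderivation
    ([contract_wedge]); both the adjunction above and the orthonormality
    computations follow from that identity. *)

(** * The exterior algebra: associativity, unit, alternation *)

Section ExteriorAlgebra.
Variables (R : realType) (n : nat).
Implicit Types (I J K : {set 'I_n}) (x y z : ext R n) (v w : 'rV[R]_n) (a : R).

Lemma ext_decomp x : x = \sum_I x I *: ext_basis R I.
Proof.
apply/ffunP => K; rewrite sum_ffunE (bigD1 K) //= big1 => [|I neIK];
  rewrite !ffunE ?eqxx ?addr0; first by rewrite /GRing.scale /= mulr1.
by rewrite eq_sym (negPf neIK) scaler0.
Qed.

Lemma wedge_is_linear x : linear (wedge x).
Proof.
move=> a y1 y2; apply/ffunP => K; rewrite !ffunE scaler_sumr -big_split /=.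
apply: eq_bigr => I _; rewrite !ffunE /GRing.scale /= mulrDr.
by rewrite mulrCA !mulrA.
Qed.

HB.instance Definition _ x :=
  GRing.isLinear.Build R (ext R n) (ext R n) _ (wedge x) (wedge_is_linear x).

(** The wedge product with its arguments exchanged, so that linearity in the
    first factor can be registered as a linear structure too. *)
Definition rwedge y x := wedge x y.

Lemma rwedge_is_linear y : linear (rwedge y).
Proof.
move=> a x1 x2; apply/ffunP => K; rewrite !ffunE scaler_sumr -big_split /=.
apply: eq_bigr => I _; rewrite !ffunE /GRing.scale /= mulrDr mulrDl.
by rewrite mulrCA !mulrA.
Qed.

HB.instance Definition _ y :=
  GRing.isLinear.Build R (ext R n) (ext R n) _ (rwedge y) (rwedge_is_linear y).

Lemma wedge0l y : wedge 0 y = 0.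
Proof. exact: (linear0 (rwedge y)). Qed.
Lemma wedgeDl x1 x2 y : wedge (x1 + x2) y = wedge x1 y + wedge x2 y.
Proof. exact: (linearD (rwedge y)). Qed.
Lemma wedgeZl a x y : wedge (a *: x) y = a *: wedge x y.
Proof. exact: (linearZ_LR (rwedge y)). Qed.
Lemma wedge_suml (T : finType) (F : T -> ext R n) y :
  wedge (\sum_i F i) y = \sum_i wedge (F i) y.
Proof. exact: (linear_sum (rwedge y)). Qed.
Lemma wedge0r x : wedge x 0 = 0.
Proof. exact: linear0. Qed.
Lemma wedgeZr a x y : wedge x (a *: y) = a *: wedge x y.
Proof. exact: linearZ. Qed.
Lemma wedge_sumr (T : finType) (F : T -> ext R n) x :
  wedge x (\sum_i F i) = \sum_i wedge x (F i).
Proof. exact: linear_sum. Qed.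

(** In the sum defining the coefficient at [K], only the term at [I] can be
    nonzero, and it is so only when [K :\: I] is [J]. *)
Lemma wedge_basis I J :
  wedge (ext_basis R I) (ext_basis R J) =
  if [disjoint I & J] then (-1) ^+ inversions I J *: ext_basis R (I :|: J) else 0.
Proof.
apply/ffunP => K; rewrite !ffunE big_mkcond (bigD1 I) //=.
rewrite big1 ?addr0 => [|L neLI]; last first.
  by rewrite !ffunE (negPf neLI) mulr0 mul0r if_same.
rewrite !ffunE eqxx mulr1.
have [dIJ|ndIJ] := boolP [disjoint I & J]; last first.
  rewrite ffunE; case: ifP => // sIK; case: eqP => [eJ|]; last by rewrite mulr0.
  by rewrite -eJ -setI_eq0 setIDA (setIC I) -setIDA setDv setI0 eqxx in ndIJ.
rewrite !ffunE; case: (eqVneq K (I :|: J)) => [->|neK].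
  rewrite subsetUl setDUl setDv set0U.
  have /setDidPl -> : [disjoint J & I] by rewrite disjoint_sym.
  by rewrite eqxx.
case: ifP => [sIK|_]; rewrite ?scaler0 //.
case: eqP => [eJ|]; rewrite ?mulr0 //.
by rewrite -eJ -{1}(setIidPr sIK) setID eqxx in neK.
Qed.

Lemma inversionsUl I J K : [disjoint I & J] ->
  inversions (I :|: J) K = (inversions I K + inversions J K)%N.
Proof.
move=> dIJ; rewrite /inversions -cardsUI [X in (_ + X)%N]eq_card0 ?addn0 => [|[i j]].
  by apply: eq_card => -[i j]; rewrite !inE /= andb_orl.
rewrite !inE /=; case Ii: (i \in I) => //=.
by rewrite (disjointFr dIJ Ii) andbF.
Qed.

Lemma inversionsUr I J K : [disjoint J & K] ->
  inversions I (J :|: K) = (inversions I J + inversions I K)%N.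
Proof.
move=> dJK; rewrite /inversions -cardsUI [X in (_ + X)%N]eq_card0 ?addn0 => [|[i j]].
  by apply: eq_card => -[i j]; rewrite !inE /= andb_orl andb_orr.
rewrite !inE /=; case Jj: (j \in J); rewrite ?andbF //=.
by rewrite (disjointFr dJK Jj) !andbF.
Qed.

(** By trilinearity it suffices to compare the signs on basis elements, where
    inversions add up over disjoint unions. *)
Lemma wedgeA : associative (@wedge R n).
Proof.
move=> x y z; rewrite (ext_decomp x) !wedge_suml; apply: eq_bigr => I _.
rewrite !wedgeZl; congr (_ *: _).
rewrite (ext_decomp y) wedge_suml !wedge_sumr wedge_suml; apply: eq_bigr => J _.
rewrite wedgeZl !wedgeZr wedgeZl; congr (_ *: _).
rewrite (ext_decomp z) !wedge_sumr; apply: eq_bigr => K _.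
rewrite !wedgeZr; congr (_ *: _).
have dUl : [disjoint I :|: J & K] = [disjoint I & K] && [disjoint J & K].
  by rewrite -!setI_eq0 setIUl setU_eq0.
have dUr : [disjoint I & J :|: K] = [disjoint I & J] && [disjoint I & K].
  by rewrite -!setI_eq0 setIUr setU_eq0.
rewrite !wedge_basis; case: (boolP [disjoint I & J]) => dIJ; last first.
  rewrite wedge0l; case: ifP; rewrite ?wedge0r // wedgeZr wedge_basis dUr.
  by rewrite (negPf dIJ) scaler0.
rewrite wedgeZl wedge_basis dUl; case: (boolP [disjoint J & K]) => dJK; last first.
  by rewrite wedge0r andbF scaler0.
rewrite wedgeZr wedge_basis dUr dIJ andbT /=.
case: ifP => _; rewrite ?scaler0 // !scalerA -!exprD setUA.
by rewrite inversionsUl // inversionsUr // addnC addnA.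
Qed.

Lemma inversions0l J : inversions set0 J = 0%N.
Proof. by apply: eq_card0 => -[i j]; rewrite !inE. Qed.
Lemma inversions0r I : inversions I set0 = 0%N.
Proof. by apply: eq_card0 => -[i j]; rewrite !inE andbF. Qed.

Lemma wedge1l : left_id (ext_basis R set0) (@wedge R n).
Proof.
move=> x; rewrite {1}(ext_decomp x) wedge_sumr [RHS]ext_decomp.
apply: eq_bigr => I _; rewrite wedgeZr wedge_basis inversions0l set0U expr0 scale1r.
by rewrite -setI_eq0 set0I eqxx.
Qed.

Lemma wedge1r : right_id (ext_basis R set0) (@wedge R n).
Proof.
move=> x; rewrite {1}(ext_decomp x) wedge_suml [RHS]ext_decomp.
apply: eq_bigr => I _; rewrite wedgeZl wedge_basis inversions0r setU0 expr0 scale1r.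
by rewrite -setI_eq0 setI0 eqxx.
Qed.

HB.instance Definition _ :=
  Monoid.isLaw.Build (ext R n) (ext_basis R set0) (@wedge R n) wedgeA wedge1l wedge1r.

Lemma vec_is_linear : linear (@vec R n).
Proof.
move=> a v w; rewrite /vec scaler_sumr -big_split; apply: eq_bigr => i _ /=.
by rewrite !mxE scalerA scalerDl.
Qed.

HB.instance Definition _ :=
  GRing.isLinear.Build R 'rV[R]_n (ext R n) _ (@vec R n) vec_is_linear.

Lemma inversions1 (i : 'I_n) I : inversions [set i] I = #|[set j in I | (j < i)%N]|.
Proof.
rewrite /inversions -(card_imset (mem [set j in I | (j < i)%N]) (f := pair i));
  last by move=> ? ? [].
apply: eq_card => -[k j]; rewrite !inE /=; apply/idP/imsetP.
  by case/and3P=> /eqP-> Ij lji; exists j; rewrite // inE Ij.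
by case=> j'; rewrite inE => /andP[Ij' lji] [-> ->]; rewrite eqxx Ij'.
Qed.

(** Of two distinct indices exactly one order is an inversion: this is the
    sign of the anticommutation relations. *)
Lemma inversions_swap (i j : 'I_n) : i != j ->
  (-1) ^+ inversions [set i] [set j] = - (-1) ^+ inversions [set j] [set i] :> R.
Proof.
have inv1 (k l : 'I_n) : inversions [set k] [set l] = (l < k)%N.
  rewrite inversions1; case: (ltnP l k) => lkl; last first.
    by apply: eq_card0 => r; rewrite !inE; case: eqP => // ->; rewrite ltnNge lkl.
  rewrite (_ : [set _ in _ | _] = [set l]) ?cards1 //.
  by apply/setP=> r; rewrite !inE; case: eqP => // ->.
by rewrite !inv1 -val_eqE /=; case: ltngtP => //= _ _; rewrite ?opprK.
Qed.

Lemma vec_delta (i : 'I_n) : vec (delta_mx 0 i) = ext_basis R [set i].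
Proof.
rewrite /vec (bigD1 i) //= big1 => [|j neji]; first by rewrite addr0 mxE !eqxx scale1r.
by rewrite mxE (negPf neji) andbF scale0r.
Qed.

Lemma vec_anticomm v w : wedge (vec v) (vec w) = - wedge (vec w) (vec v).
Proof.
rewrite /vec wedge_suml wedge_sumr -sumrN; apply: eq_bigr => i _.
rewrite wedge_sumr wedge_suml -sumrN; apply: eq_bigr => j _.
rewrite !wedgeZl !wedgeZr !wedge_basis !scalerA mulrC -scalerN; congr (_ *: _).
rewrite !disjoints1 !inE (eq_sym j) setUC.
case: eqP => [|/eqP neij]; first by rewrite oppr0.
by rewrite inversions_swap // scaleNr.
Qed.

Lemma vec_alt v : wedge (vec v) (vec v) = 0.
Proof.
have /eqP := vec_anticomm v v; rewrite -addr_eq0 -mulr2n -scaler_nat.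
by rewrite scaler_eq0 pnatr_eq0 => /eqP.
Qed.

Lemma ext_basisD1 (i : 'I_n) I : i \in I ->
  ext_basis R I = (-1) ^+ inversions [set i] (I :\ i) *:
    wedge (vec (delta_mx 0 i)) (ext_basis R (I :\ i)).
Proof.
move=> Ii; rewrite vec_delta wedge_basis disjoints1 !inE eqxx /= scalerA -signr_odd.
by rewrite -expr2 sqrr_sign scale1r setD1K.
Qed.

(** The exterior algebra is generated by vectors: a linear property that holds
    of the unit and survives left multiplication by vectors holds everywhere.
    Identities that are hard to see on coefficients are proved this way below. *)
Lemma ext_ind (P : ext R n -> Prop) :
  P (ext_basis R set0) -> (forall a x y, P x -> P y -> P (a *: x + y)) ->
  (forall v x, P x -> P (wedge (vec v) x)) -> forall x, P x.
Proof.
move=> P1 PD PM x; have P0 : P 0.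
  by rewrite -(subrr (ext_basis R set0)) addrC -scaleN1r; apply: PD.
rewrite (ext_decomp x); elim/big_rec: _ => // I y _ Py; apply: (PD) => // {y Py}.
elim: {I}#|I| {-2}I (leqnn #|I|) => [|k IH] I.
  by rewrite leqn0 cards_eq0 => /eqP ->.
move=> leIk; have [->//|[i Ii]] := set_0Vmem I.
rewrite (ext_basisD1 Ii) -[_ *: _]addr0; apply: PD => //; apply/PM/IH.
by rewrite (cardsD1 i) Ii in leIk.
Qed.
End ExteriorAlgebra.

(** * Inner product and contraction *)

Section Pairing.
Variables (R : realType) (n : nat).
Implicit Types (I J K : {set 'I_n}) (x y z : ext R n) (v w : 'rV[R]_n) (a : R).

Lemma pairingC x y : pairing x y = pairing y x.
Proof. by apply: eq_bigr => I _; rewrite mulrC. Qed.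

Lemma pairing_is_linear x : linear (pairing x : ext R n -> R^o).
Proof.
move=> a y z; rewrite /pairing scaler_sumr -big_split; apply: eq_bigr => I _ /=.
by rewrite !ffunE /GRing.scale /= mulrDr mulrCA.
Qed.

HB.instance Definition _ x :=
  GRing.isLinear.Build R (ext R n) R^o _ (pairing x) (pairing_is_linear x).

Lemma pairingDr x y z : pairing x (y + z) = pairing x y + pairing x z.
Proof. exact: linearD. Qed.
Lemma pairingDl x y z : pairing (x + y) z = pairing x z + pairing y z.
Proof. by rewrite !(pairingC _ z) pairingDr. Qed.
Lemma pairingZr a x y : pairing x (a *: y) = a * pairing x y.
Proof. by rewrite linearZ. Qed.
Lemma pairingZl a x y : pairing (a *: x) y = a * pairing x y.
Proof. by rewrite !(pairingC _ y) pairingZr. Qed.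
Lemma pairing_sumr (T : finType) (F : T -> ext R n) x :
  pairing x (\sum_i F i) = \sum_i pairing x (F i).
Proof. exact: (linear_sum (pairing x)). Qed.
Lemma pairing0r x : pairing x 0 = 0.
Proof. exact: (linear0 (pairing x)). Qed.
Lemma pairingNr x y : pairing x (- y) = - pairing x y.
Proof. exact: (linearN (pairing x)). Qed.

Lemma pairing_basisr x I : pairing x (ext_basis R I) = x I.
Proof.
rewrite /pairing (bigD1 I) //= big1 => [|J neJI]; rewrite ffunE ?eqxx ?mulr1 ?addr0 //.
by rewrite (negPf neJI) mulr0.
Qed.

Lemma enorm_sqr x : enorm x ^+ 2 = pairing x x.
Proof.
rewrite /enorm sqr_sqrtr; first by apply: eq_bigr => I _; rewrite expr2.
by apply: sumr_ge0 => I _; apply: sqr_ge0.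
Qed.

Lemma enorm_ge0 x : 0 <= enorm x.
Proof. exact: sqrtr_ge0. Qed.

Lemma enormE x : enorm x = Num.sqrt (pairing x x).
Proof. by rewrite -enorm_sqr sqrtr_sqr ger0_norm ?enorm_ge0. Qed.

Lemma enormZ a x : enorm (a *: x) = `|a| * enorm x.
Proof.
by rewrite !enormE pairingZl pairingZr mulrA -expr2 sqrtrM ?sqr_ge0 // sqrtr_sqr.
Qed.

Lemma enorm_basis I : enorm (ext_basis R I) = 1.
Proof. by rewrite enormE pairing_basisr ffunE eqxx sqrtr1. Qed.

Lemma enorm_eq0 x : (enorm x == 0) = (x == 0).
Proof.
apply/eqP/eqP => [x0|->]; last by rewrite enormE pairing0r sqrtr0.
have : pairing x x == 0 by rewrite -enorm_sqr x0 expr0n.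
rewrite psumr_eq0 => [/allP x00|I _]; last by rewrite -expr2 sqr_ge0.
apply/ffunP => I; have := x00 I (mem_index_enum _).
by rewrite mulf_eq0 orbb ffunE => /eqP.
Qed.

Lemma enorm0 : enorm (0 : ext R n) = 0.
Proof. by apply/eqP; rewrite enorm_eq0. Qed.

(** Expand the squared norm of [enorm y *: x - enorm x *: y] and divide by
    [2 * enorm x * enorm y]. *)
Lemma Cauchy_Schwarz x y : pairing x y <= enorm x * enorm y.
Proof.
have [->|x0] := eqVneq x 0; first by rewrite pairingC pairing0r mulr_ge0 ?enorm_ge0.
have [->|y0] := eqVneq y 0; first by rewrite pairing0r mulr_ge0 ?enorm_ge0.
have ex : 0 < enorm x by rewrite lt0r enorm_eq0 x0 enorm_ge0.
have ey : 0 < enorm y by rewrite lt0r enorm_eq0 y0 enorm_ge0.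
have := sqr_ge0 (enorm (enorm y *: x - enorm x *: y)).
rewrite enorm_sqr pairingDl -scaleN1r !pairingDr !pairingZl !pairingZr (pairingC y x).
rewrite -!enorm_sqr => H.
rewrite -(ler_pM2l ex) -(ler_pM2l ey).
suff : 0 <= 2 * (enorm y * (enorm x * (enorm x * enorm y))
                 - enorm y * (enorm x * pairing x y)).
  by rewrite pmulr_rge0 // subr_ge0.
by apply: le_trans H _; rewrite le_eqVlt; apply/orP; left; apply/eqP; ring.
Qed.

Lemma normr_pairing x y : `|pairing x y| <= enorm x * enorm y.
Proof.
rewrite ler_norml Cauchy_Schwarz andbT lerNl -pairingNr -scaleN1r.
by apply: le_trans (Cauchy_Schwarz _ _) _; rewrite enormZ normrN1 mul1r.
Qed.

(** Interior multiplication by [v], given by its coefficients so that it is by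
    construction the adjoint of the wedge product by [v]. *)
Definition contract v y : ext R n :=
  [ffun K : {set 'I_n} => pairing (wedge (vec v) (ext_basis R K)) y].

Lemma pairing_contract v x y : pairing (wedge (vec v) x) y = pairing x (contract v y).
Proof.
rewrite pairingC {1}(ext_decomp x) wedge_sumr pairing_sumr; apply: eq_bigr => I _.
by rewrite wedgeZr pairingZr pairingC ffunE.
Qed.

Lemma contractZDr a v x y : contract v (a *: x + y) = a *: contract v x + contract v y.
Proof. by apply/ffunP => K; rewrite !ffunE pairingDr pairingZr. Qed.

Lemma delta_wedgeE (i : 'I_n) y K : wedge (vec (delta_mx 0 i)) y K =
  if i \in K then (-1) ^+ inversions [set i] (K :\ i) * y (K :\ i) else 0.
Proof.
rewrite vec_delta ffunE big_mkcond (bigD1 [set i]) //= sub1set ffunE eqxx mulr1.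
rewrite big1 ?addr0 => [|I neI]; last by rewrite ffunE (negPf neI) mulr0 mul0r if_same.
by [].
Qed.

Lemma contract_deltaE (i : 'I_n) y K : contract (delta_mx 0 i) y K =
  if i \in K then 0 else (-1) ^+ inversions [set i] K * y (i |: K).
Proof.
rewrite ffunE pairingC vec_delta wedge_basis disjoints1.
by case: (i \in K); rewrite ?pairing0r // pairingZr pairing_basisr.
Qed.

(** The canonical anticommutation relations between creation and annihilation
    operators.  For distinct indices, exchanging the removal of [i] and the
    insertion of [j] costs the sign of [inversions_swap]. *)
Lemma contract_delta_wedge (i j : 'I_n) y :
  contract (delta_mx 0 i) (wedge (vec (delta_mx 0 j)) y) =
  (i == j)%:R *: y - wedge (vec (delta_mx 0 j)) (contract (delta_mx 0 i) y).
Proof.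
have subE a (s t : ext R n) K : (a *: s - t) K = a * s K - t K by rewrite !ffunE.
apply/ffunP => K; rewrite contract_deltaE subE !delta_wedgeE contract_deltaE.
rewrite !inE (eq_sym j).
case: (eqVneq i j) => [<-|neij] /=.
  case: ifP => Ki; rewrite mul1r ?eqxx /= ?Ki.
    by rewrite setD1K // mulrA -expr2 sqrr_sign mul1r subrr.
  by rewrite setU1K ?Ki // mulrA -expr2 sqrr_sign mul1r subr0.
rewrite mul0r sub0r; case Kj: (j \in K); last by rewrite mulr0 oppr0; case: ifP.
case: (boolP (i \in K)) => Ki; first by rewrite mulr0 oppr0.
have -> : (i |: K) :\ j = i |: (K :\ j).
  apply/setP => k; rewrite !inE; case: (eqVneq k i) => [->|_] //=; by rewrite neij.
rewrite -{1}(setD1K Kj) inversionsUr ?disjoints1 ?inE ?eqxx //.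
rewrite (@inversionsUr _ [set j] [set i]) ?disjoints1 ?inE ?(negPf Ki) ?andbF //.
have := sqrr_sign R (inversions [set j] [set i]).
rewrite !exprD (inversions_swap R neij); move: ((-1) ^+ _) => e e2.
by rewrite -[RHS]mul1r -e2; ring.
Qed.

Lemma contract_row v y : contract v y = \sum_i v 0 i *: contract (delta_mx 0 i) y.
Proof.
apply/ffunP => K; rewrite sum_ffunE ffunE {1}(row_sum_delta v) linear_sum /=.
rewrite wedge_suml pairingC pairing_sumr; apply: eq_bigr => i _.
by rewrite linearZ wedgeZl pairingZr !ffunE pairingC.
Qed.

Lemma contract_sumr (T : finType) (F : T -> ext R n) v :
  contract v (\sum_i F i) = \sum_i contract v (F i).
Proof.
apply/ffunP => K; rewrite sum_ffunE ffunE pairing_sumr.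
by apply: eq_bigr => i _; rewrite ffunE.
Qed.

Lemma contractZr a v x : contract v (a *: x) = a *: contract v x.
Proof. by apply/ffunP => K; rewrite !ffunE pairingZr. Qed.

(** Contraction is an antiderivation for the wedge product by a vector; this is
    the bilinear extension of [contract_delta_wedge]. *)
Lemma contract_wedge v w y :
  contract v (wedge (vec w) y) = (v *m w^T) 0 0 *: y - wedge (vec w) (contract v y).
Proof.
rewrite (contract_row v y) (contract_row v) {1 3}(row_sum_delta w) linear_sum /=.
have -> : (v *m w^T) 0 0 *: y = \sum_i \sum_j (v 0 i * w 0 j * (i == j)%:R) *: y.
  rewrite mxE scaler_suml; apply: eq_bigr => i _.
  rewrite (bigD1 i) //= big1 ?addr0 => [|j]; first by rewrite eqxx mulr1 mxE.
  by rewrite eq_sym => /negPf ->; rewrite mulr0 scale0r.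
rewrite wedge_suml wedge_sumr -sumrB; apply: eq_bigr => i _.
rewrite contract_sumr wedge_suml scaler_sumr -sumrB; apply: eq_bigr => j _.
rewrite linearZ /= !wedgeZl contractZr contract_delta_wedge wedgeZr.
by rewrite !scalerBr !scalerA (mulrC (w 0 j)).
Qed.

End Pairing.


(** * Homomorphisms induced by matrices *)

(** The action on the exterior algebra of the linear map [v |-> v *m A], for
    row vectors [v]; the factors of the product over [I] occur in increasing
    order of their indices. *)
Definition induced (R : realType) (n k : nat) (A : 'M[R]_(n, k)) (x : ext R n)
    : ext R k :=
  \sum_(I : {set 'I_n}) x I *:
    \big[@wedge R k/ext_basis R set0]_(i in I) vec (row i A).

Lemma induced_is_linear (R : realType) n k (A : 'M[R]_(n, k)) : linear (induced A).
Proof.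
move=> a x y; rewrite /induced scaler_sumr -big_split; apply: eq_bigr => I _ /=.
by rewrite !ffunE scalerDl scalerA.
Qed.

HB.instance Definition _ (R : realType) n k (A : 'M[R]_(n, k)) :=
  GRing.isLinear.Build R (ext R n) (ext R k) _ (induced A) (induced_is_linear A).

Lemma inducedZD (R : realType) n k (A : 'M[R]_(n, k)) a x y :
  induced A (a *: x + y) = a *: induced A x + induced A y.
Proof. exact: linearP. Qed.

Section InducedWedge.
Variables (R : realType) (n k : nat) (A : 'M[R]_(n, k)).
Implicit Types (I J : {set 'I_n}) (x y : ext R n) (v : 'rV[R]_n).

Lemma induced_basis I : induced A (ext_basis R I) =
  \big[@wedge R k/ext_basis R set0]_(i in I) vec (row i A).
Proof.
rewrite /induced (bigD1 I) //= ffunE eqxx scale1r [X in _ + X]big1 ?addr0 // => J neJI.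
by rewrite ffunE (negPf neJI) scale0r.
Qed.

(** Inserting one more factor at the front of an ordered product and moving it
    to its place costs one sign per smaller index.  The order is carried by a
    sorted list so that the product can be taken apart by induction. *)
Lemma wedge_insert (s : seq 'I_n) I (i : 'I_n) : sorted ltn (map val s) -> i \in s ->
  wedge (vec (row i A))
    (\big[@wedge R k/ext_basis R set0]_(j <- s | j \in I) vec (row j A)) =
  if i \in I then 0 else
    (-1) ^+ count (fun j : 'I_n => (j \in I) && (j < i)%N) s *:
    \big[@wedge R k/ext_basis R set0]_(j <- s | j \in i |: I) vec (row j A).
Proof.
elim: s => // j s IH /= so; rewrite in_cons.
have gtj : {in s, forall l : 'I_n, (j < l)%N}.
  move=> l ls; move: so; rewrite (path_sortedE ltn_trans) all_map.
  by case/andP=> /allP/(_ l ls).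
have {IH} := IH (path_sorted so); rewrite !big_cons !inE.
case: (eqVneq i j) gtj => [<- {so} gtj|neij gtj] IH /=.
  move=> _; case: (boolP (i \in I)) => Ii; first by rewrite wedgeA vec_alt wedge0l.
  rewrite (_ : count _ _ = 0%N); last first.
    apply/eqP; rewrite -leqn0 leqNgt -has_count; apply/hasPn => l /gtj/ltnW.
    by rewrite negb_and -leqNgt => ->; rewrite orbT.
  rewrite ltnn andbF expr0 scale1r; congr (wedge _ _).
  rewrite big_seq_cond [RHS]big_seq_cond; apply: eq_bigl => l.
  rewrite !inE; case ls: (l \in s) => //=; case: eqP => [eli|] //=.
  by have := gtj _ ls; rewrite eli ltnn.
move=> is_; rewrite (gtj _ is_) andbT.
have {IH}IH := IH is_.
case: (boolP (j \in I)) => Ij; last by rewrite IH add0n.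
rewrite wedgeA vec_anticomm -scaleN1r wedgeZl -wedgeA IH.
case: ifP => _; first by rewrite wedge0r scaler0.
by rewrite wedgeZr scalerA add1n exprS.
Qed.

(** Both sides are linear in [v] and [x]; on basis elements this is
    [wedge_insert], whose sign is the one of [wedge_basis]. *)
Lemma induced_vec_wedge v x :
  induced A (wedge (vec v) x) = wedge (vec (v *m A)) (induced A x).
Proof.
rewrite (row_sum_delta v) mulmx_suml (linear_sum (@vec R n)) (linear_sum (@vec R k)).
rewrite !wedge_suml (linear_sum (induced A)); apply: eq_bigr => i _.
rewrite -scalemxAl (linearZ_LR (@vec R n)) (linearZ_LR (@vec R k)) !wedgeZl.
rewrite (linearZ_LR (induced A)) -rowE; congr (_ *: _).
rewrite (ext_decomp x) wedge_sumr !(linear_sum (induced A)) wedge_sumr.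
apply: eq_bigr => I _; rewrite wedgeZr !(linearZ_LR (induced A)) wedgeZr.
congr (_ *: _).
rewrite /= vec_delta wedge_basis !induced_basis.
have E (P : pred 'I_n) : \big[@wedge R k/ext_basis R set0]_(j | P j) vec (row j A) =
  \big[@wedge R k/ext_basis R set0]_(j <- enum 'I_n | P j) vec (row j A).
  by rewrite enumT.
rewrite (E (mem I)) wedge_insert ?mem_enum //; last first.
  by rewrite val_enum_ord iota_ltn_sorted.
rewrite disjoints1; case: (i \in I); rewrite /= ?linear0 //.
rewrite (linearZ_LR (induced A)) /= induced_basis (E (mem (i |: I))).
congr (_ ^+ _ *: _); rewrite inversions1.
by rewrite enumT cardE /enum_mem size_filter; apply: eq_count => j /=; rewrite !inE.
Qed.

Lemma induced1 : induced A (ext_basis R set0) = ext_basis R set0.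
Proof. by rewrite induced_basis big1 // => i; rewrite inE. Qed.

Lemma induced_wedge x y : induced A (wedge x y) = wedge (induced A x) (induced A y).
Proof.
elim/ext_ind: x => [|a x1 x2 IH1 IH2|v x IH].
- by rewrite induced1 !wedge1l.
- by rewrite inducedZD !wedgeDl !wedgeZl -IH1 -IH2 inducedZD.
- by rewrite -wedgeA !induced_vec_wedge IH wedgeA.
Qed.

Lemma induced_wedges m (x : 'I_m -> ext R n) :
  induced A (wedges x) = wedges (fun i => induced A (x i)).
Proof. exact: (big_morph _ induced_wedge induced1). Qed.

Lemma induced_setT : induced A (ext_basis R setT) = wedges (fun i => vec (row i A)).
Proof. by rewrite induced_basis; apply: eq_bigl => i; rewrite inE. Qed.

End InducedWedge.

Lemma induced_comp (R : realType) n k l (A : 'M[R]_(n, k)) (B : 'M[R]_(k, l)) x :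
  induced B (induced A x) = induced (A *m B) x.
Proof.
elim/ext_ind: x => [|a x1 x2 IH1 IH2|v x IH].
- by rewrite !induced1.
- by rewrite !inducedZD IH1 IH2.
- by rewrite !induced_vec_wedge IH mulmxA.
Qed.

Lemma induced_id (R : realType) n x : induced (1%:M : 'M[R]_n) x = x.
Proof.
elim/ext_ind: x => [|a x1 x2 IH1 IH2|v x IH].
- by rewrite !induced1.
- by rewrite !inducedZD IH1 IH2.
- by rewrite !induced_vec_wedge IH mulmx1.
Qed.

Lemma contract1 (R : realType) n (u : 'rV[R]_n) : contract u (ext_basis R set0) = 0.
Proof.
apply/ffunP => K; rewrite contract_row sum_ffunE big1 ?ffunE // => i _.
rewrite ffunE contract_deltaE; case: ifP; rewrite ?scaler0 // ffunE.
by rewrite -subset0 subUset sub1set inE mulr0 scaler0.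
Qed.

(** Contraction is adjoint to the wedge product, so that it is pulled back where
    the wedge product is pushed forward. *)
Lemma contract_induced (R : realType) n k (A : 'M[R]_(n, k)) (v : 'rV[R]_k)
    (y : ext R n) :
  contract v (induced A y) = induced A (contract (v *m A^T) y).
Proof.
elim/ext_ind: y v => [|a x1 x2 IH1 IH2|w x IH] v.
- by rewrite induced1 !contract1 linear0.
- by rewrite inducedZD !contractZDr IH1 IH2 inducedZD.
- rewrite induced_vec_wedge !contract_wedge linearB linearZ /= induced_vec_wedge IH.
  by rewrite trmx_mul mulmxA.
Qed.

(** The adjoint of the map induced by [A] is induced by its transpose.  Vector
    factors of [x] are moved to the other side as contractions, which commute
    with induced maps by [contract_induced]. *)
Lemma pairing_induced (R : realType) n k (A : 'M[R]_(n, k)) (x : ext R n)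
    (y : ext R k) :
  pairing (induced A x) y = pairing x (induced A^T y).
Proof.
elim/ext_ind: x y => [|a x1 x2 IH1 IH2|v x IH] y.
- rewrite induced1 pairingC [RHS]pairingC.
  elim/ext_ind: y => [|a y1 y2 IH1 IH2|w y _].
  + by rewrite induced1 !pairing_basisr !ffunE !eqxx.
  + by rewrite inducedZD !pairingDl !pairingZl IH1 IH2.
  + by rewrite induced_vec_wedge !pairing_contract !contract1 !pairing0r.
- by rewrite inducedZD !pairingDl !pairingZl IH1 IH2.
- by rewrite induced_vec_wedge !pairing_contract IH contract_induced trmxK.
Qed.

(** * Degrees, orthonormal frames and Hodge duality *)

Section Degree.
Variables (R : realType) (n : nat).
Implicit Types (I J K : {set 'I_n}) (x y z : ext R n) (v w : 'rV[R]_n) (a : R).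

Lemma Lambda_basis I : Lambda #|I| (ext_basis R I).
Proof.
by move=> K neK; rewrite ffunE; case: (eqVneq K I) neK => // ->; rewrite eqxx.
Qed.

Lemma LambdaZ p a x : Lambda p x -> Lambda p (a *: x).
Proof. by move=> px K neK; rewrite ffunE px // scaler0. Qed.

Lemma wedge_Lambda p q x y : Lambda p x -> Lambda q y -> Lambda (p + q) (wedge x y).
Proof.
move=> px qy K neK; rewrite ffunE big1 // => I sIK.
have [pI|neI] := eqVneq #|I| p; last by rewrite px // mulr0 mul0r.
rewrite qy ?mulr0 // cardsDS // pI; apply: contra neK => /eqP <-.
by rewrite subnKC // -pI subset_leq_card.
Qed.

Lemma vec_Lambda v : Lambda 1 (vec v).
Proof.
move=> K neK; rewrite /vec sum_ffunE big1 // => i _; rewrite !ffunE.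
by case: (eqVneq K [set i]) neK => [->|_]; rewrite ?cards1 ?eqxx // scaler0.
Qed.

Lemma wedges_Lambda m p (x : 'I_m -> ext R n) :
  (forall i, Lambda p (x i)) -> Lambda (m * p) (wedges x).
Proof.
elim: m x => [|m IH] x px; rewrite /wedges.
  by rewrite big_ord0 mul0n -(cards0 'I_n); apply: Lambda_basis.
by rewrite big_ord_recl mulSn; apply: wedge_Lambda => //; apply: IH.
Qed.

Lemma Lambda_top x : Lambda n x -> x = x setT *: ext_basis R setT.
Proof.
move=> nx; apply/ffunP => K; rewrite !ffunE.
case: (eqVneq K setT) => [->|neK]; first by rewrite /GRing.scale /= mulr1.
rewrite scaler0 nx //; apply: contra neK => /eqP cK.
by rewrite eqEcard subsetT cardsT card_ord cK leqnn.
Qed.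

Lemma enorm_top x : Lambda n x -> enorm x = `|x setT|.
Proof. by move=> nx; rewrite {1}(Lambda_top nx) enormZ enorm_basis mulr1. Qed.

End Degree.

Lemma induced_Lambda (R : realType) n k (A : 'M[R]_(n, k)) p (x : ext R n) :
  Lambda p x -> Lambda p (induced A x).
Proof.
have basis c (I : {set 'I_n}) : #|I| = c -> Lambda c (induced A (ext_basis R I)).
  elim: c I => [|c IH] I cI.
    by rewrite (cards0_eq cI) induced1 -(cards0 'I_k); apply: Lambda_basis.
  have [I0|[i Ii]] := set_0Vmem I; first by rewrite I0 cards0 in cI.
  rewrite (ext_basisD1 R Ii) (linearZ_LR (induced A)) /= induced_vec_wedge.
  apply: LambdaZ; rewrite -add1n; apply: wedge_Lambda; first exact: vec_Lambda.
  by apply: IH; move: cI; rewrite (cardsD1 i) Ii => -[].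
move=> px K neK; rewrite (ext_decomp x) (linear_sum (induced A)) sum_ffunE.
rewrite big1 // => I _.
rewrite (linearZ_LR (induced A)) /= ffunE.
have [pI|neI] := eqVneq #|I| p; first by rewrite (basis p I pI) // scaler0.
by rewrite px // scale0r.
Qed.

Section Orthonormal.
Variables (R : realType) (n : nat).
Implicit Types (x y z : ext R n) (v w : 'rV[R]_n) (a : R).

(** Frames are kept as the rows of a matrix [U], and [U *m U^T = 1%:M] says that
    the frame is orthonormal. *)
Definition wedge_rows m (U : 'M[R]_(m, n)) : ext R n := wedges (fun i => vec (row i U)).

Lemma wedge_rows_col_mx p q (U : 'M[R]_(p, n)) (W : 'M[R]_(q, n)) :
  wedge_rows (col_mx U W) = wedge (wedge_rows U) (wedge_rows W).
Proof.
rewrite /wedge_rows /wedges big_split_ord /=; congr wedge; apply: eq_bigr => i _.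
  by rewrite rowKu.
by rewrite rowKd.
Qed.

Lemma wedge_rows1 v : wedge_rows v = vec v.
Proof. by rewrite /wedge_rows /wedges big_ord1 row_id. Qed.

Lemma wedge_rows0 (U : 'M[R]_(0, n)) : wedge_rows U = ext_basis R set0.
Proof. by rewrite /wedge_rows /wedges big_ord0. Qed.

Lemma wedge_rows_Lambda m (U : 'M[R]_(m, n)) : Lambda m (wedge_rows U).
Proof.
by rewrite -[m in Lambda m]muln1; apply: wedges_Lambda => i; apply: vec_Lambda.
Qed.

(** Contraction by a vector orthogonal to every factor passes through the
    product, up to signs. *)
Lemma contract_rows m (W : 'M[R]_(m, n)) v y :
  v *m W^T = 0 -> contract v y = 0 -> contract v (wedge (wedge_rows W) y) = 0.
Proof.
elim/col_ind: m / W => [W _|m w W IH vW] vy; first by rewrite wedge_rows0 wedge1l.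
move: vW; rewrite tr_col_mx mul_mx_row => /eqP.
rewrite row_mx_eq0 => /andP[/eqP v0 /eqP vW].
rewrite wedge_rows_col_mx wedge_rows1 -wedgeA contract_wedge v0 mxE scale0r.
by rewrite IH // wedge0r subrr.
Qed.

(** Multiplication by an orthonormal frame is isometric on elements orthogonal
    to the frame: contracting by the first vector of the frame removes it, since
    the remaining factors are orthogonal to it. *)
Lemma pairing_orthonormal m (U : 'M[R]_(m, n)) x y :
  U *m U^T = 1%:M -> (forall i, contract (row i U) y = 0) ->
  pairing (wedge (wedge_rows U) x) (wedge (wedge_rows U) y) = pairing x y.
Proof.
elim/col_ind: m / U => [U|m u U IH]; first by rewrite wedge_rows0 !wedge1l.
rewrite tr_col_mx mul_col_row (scalar_mx_block 1 m) => /eq_block_mx[u1 uW _ WW] Uy.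
rewrite wedge_rows_col_mx wedge_rows1 -!wedgeA pairing_contract contract_wedge u1.
rewrite mxE eqxx scale1r contract_rows ?wedge0r ?subr0 //.
  apply: IH => // i; have := Uy (rshift 1 i); by rewrite rowKd.
by have := Uy (lshift m 0); rewrite rowKu row_id.
Qed.

Lemma enorm_rows m (U : 'M[R]_(m, n)) : U *m U^T = 1%:M -> enorm (wedge_rows U) = 1.
Proof.
move=> UU; rewrite enormE -[wedge_rows U]wedge1r pairing_orthonormal //.
  by rewrite -enormE enorm_basis.
by move=> i; rewrite contract1.
Qed.

Lemma dotmx_gt0 v : v != 0 -> 0 < (v *m v^T) 0 0.
Proof.
move=> v0; have vE : (v *m v^T) 0 0 = \sum_i v 0 i ^+ 2.
  by rewrite mxE; apply: eq_bigr => i _; rewrite mxE expr2.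
rewrite vE lt0r sumr_ge0 ?andbT => [|i _]; last exact: sqr_ge0.
apply: contra v0; rewrite psumr_eq0 => [/allP v0|i _]; last exact: sqr_ge0.
apply/eqP/rowP => i; have := v0 i (mem_index_enum _).
by rewrite mxE sqrf_eq0 => /eqP.
Qed.

Lemma normalize v : v != 0 -> exists2 s : R, s != 0 & (s *: v) *m (s *: v)^T = 1%:M.
Proof.
move=> /dotmx_gt0 v0; exists (Num.sqrt ((v *m v^T) 0 0))^-1.
  by rewrite invr_eq0 gt_eqF // sqrtr_gt0.
rewrite linearZ /= -scalemxAl -scalemxAr scalerA -invfM -expr2 sqr_sqrtr ?ltW //.
by rewrite [X in _ *: X]mx11_scalar scale_scalar_mx mulVf ?gt_eqF.
Qed.

(** A kernel vector exists since [U^T] has rank at most [m < n]. *)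
Lemma orthonormal_next m (U : 'M[R]_(m, n)) : (m < n)%N ->
  exists2 w : 'rV[R]_n, w *m w^T = 1%:M & w *m U^T = 0.
Proof.
move=> ltmn; have /rowV0Pn[v /sub_kermxP vU v0] : kermx U^T != 0.
  rewrite -mxrank_eq0 mxrank_ker subn_eq0 -ltnNge.
  by apply: leq_ltn_trans ltmn; apply: rank_leq_col.
have [s _ sv] := normalize v0; exists (s *: v) => //.
by rewrite -scalemxAl vU scaler0.
Qed.

Lemma orthonormal_col_mx p q (U : 'M[R]_(p, n)) (W : 'M[R]_(q, n)) :
  U *m U^T = 1%:M -> W *m W^T = 1%:M -> U *m W^T = 0 ->
  col_mx U W *m (col_mx U W)^T = 1%:M.
Proof.
move=> UU WW UW; have WU : W *m U^T = 0 by rewrite -[LHS]trmxK trmx_mul trmxK UW trmx0.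
by rewrite tr_col_mx mul_col_row UU WW UW WU -scalar_mx_block.
Qed.

Lemma orthonormal_complement p q (U : 'M[R]_(p, n)) : (p + q <= n)%N ->
  U *m U^T = 1%:M -> exists2 W : 'M[R]_(q, n), W *m W^T = 1%:M & U *m W^T = 0.
Proof.
move=> lepqn UU; elim: q lepqn => [|q IH] lepqn.
  by exists 0; [by apply/matrixP => -[] | by apply/matrixP => i []].
have [|W WW UW] := IH; first by rewrite (leq_trans _ lepqn) // leq_add2l.
have [|w ww] := @orthonormal_next _ (col_mx U W); first by rewrite addnS in lepqn.
rewrite tr_col_mx mul_mx_row => /eqP; rewrite row_mx_eq0 => /andP[/eqP wU /eqP wW].
rewrite -[q.+1]/(1 + q)%N; exists (col_mx w W); first exact: (orthonormal_col_mx ww).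
rewrite tr_col_mx mul_mx_row UW.
by rewrite -[U *m w^T]trmxK trmx_mul trmxK wU trmx0 row_mx0.
Qed.

Lemma wedge_rows_induced m (U : 'M[R]_(m, n)) :
  wedge_rows U = induced U (ext_basis R setT).
Proof. by rewrite induced_setT. Qed.

(** Under the map induced by [U] this is the image of a product of degree [m + 1]
    in dimension [m], which vanishes. *)
Lemma wedge_rows_absorb m (U : 'M[R]_(m, n)) (a : 'rV[R]_m) :
  wedge (vec (a *m U)) (wedge_rows U) = 0.
Proof.
rewrite wedge_rows_induced -induced_vec_wedge /vec wedge_suml big1 ?linear0 // => i _.
by rewrite wedgeZl wedge_basis disjoints1 inE scaler0.
Qed.

(** Adding to a factor a combination of the others does not change the product,
    so the first row may be replaced by its component orthogonal to the frame
    obtained for the others. *)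
Lemma Gram_Schmidt m (V : 'M[R]_(m, n)) : (m <= n)%N ->
  exists2 U : 'M[R]_(m, n), U *m U^T = 1%:M &
    exists c, wedge_rows V = c *: wedge_rows U.
Proof.
elim/col_ind: m / V => [V|m v V IH] lemn.
  by exists 0; [by apply/matrixP => -[] | exists 1; rewrite scale1r !wedge_rows0].
have [U UU [c Vc]] := IH (ltnW lemn).
pose v0 := v - (v *m U^T) *m U.
have v0U : v0 *m U^T = 0 by rewrite mulmxBl -!mulmxA UU mulmx1 subrr.
(* When [v0] vanishes any unit vector orthogonal to [U] serves, with [s = 0]. *)
have [w [ww wU [s v0s]]] : exists w : 'rV[R]_n,
    [/\ w *m w^T = 1%:M, w *m U^T = 0 & exists s, v0 = s *: w].
  have [->|/normalize[s s0 sv]] := eqVneq v0 0.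
    have [w ww wU] := orthonormal_next U lemn.
    by exists w; split => //; exists 0; rewrite scale0r.
  exists (s *: v0); split; rewrite // -?scalemxAl ?v0U ?scaler0 //.
  by exists s^-1; rewrite scalerA mulVf // scale1r.
exists (col_mx w U); first exact: (orthonormal_col_mx ww).
exists (s * c); rewrite !wedge_rows_col_mx !wedge_rows1 Vc.
have -> : v = v0 + (v *m U^T) *m U by rewrite subrK.
rewrite wedgeZr linearD /= wedgeDl wedge_rows_absorb addr0 v0s.
rewrite (linearZ_LR (@vec R n)) /=.
by rewrite wedgeZl scalerA mulrC.
Qed.

End Orthonormal.

Section Hodge.
Variables (R : realType) (n : nat).
Implicit Types (x y : ext R n).

(** The Hodge star, with the sign that makes [pairing_hodge] hold. *)
Definition hodge x : ext R n :=
  [ffun I : {set 'I_n} => (-1) ^+ inversions I (~: I) * x (~: I)].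

Lemma pairing_hodge x y : pairing x (hodge y) = wedge x y setT.
Proof.
rewrite ffunE; apply: eq_big => [I|I _]; first by rewrite subsetT.
by rewrite ffunE setTD mulrCA mulrA.
Qed.

End Hodge.

Lemma hodge_Lambda (R : realType) p r (x : ext R (p + r)) :
  Lambda r x -> Lambda p (hodge x).
Proof.
move=> rx I neI; rewrite ffunE rx ?mulr0 //; apply: contra neI => /eqP cI.
by have /eqP := cardsC I; rewrite cI card_ord eqn_add2r.
Qed.

(** * Comass and the constants C_{n,p} *)

From mathcomp Require Import all_classical all_reals.

Section Comass.
Variables (R : realType) (n : nat).
Implicit Types (phi xi x y z : ext R n) (v w : 'rV[R]_n) (a : R) (p : nat).

Lemma simple_rows p xi : simple p xi <-> exists V : 'M[R]_(p, n), xi = wedge_rows V.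
Proof.
split=> [[v ->]|[V ->]]; last by exists (fun i => row i V).
exists (\matrix_i v i); rewrite /wedge_rows; congr wedges.
by apply/funext => i; rewrite rowK.
Qed.

Lemma simple_vec_wedge p v xi : simple p xi -> simple p.+1 (wedge (vec v) xi).
Proof.
move=> /simple_rows[V ->]; apply/simple_rows.
by exists (col_mx v V); rewrite (wedge_rows_col_mx v) wedge_rows1.
Qed.

(** The scalar is absorbed in the first factor, whence [0 < p]. *)
Lemma simpleZ p a xi : (0 < p)%N -> simple p xi -> simple p (a *: xi).
Proof.
move=> p0 /simple_rows[V ->]; elim/col_ind: p / V p0 => // m v V _ _.
rewrite wedge_rows_col_mx wedge_rows1 -wedgeZl -[a *: vec v](linearZ_LR (@vec R n)).
by apply: simple_vec_wedge; apply/simple_rows; exists V.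
Qed.

Lemma simple0 p : (0 < p)%N -> simple p (0 : ext R n).
Proof.
move=> p0; rewrite -(scale0r (wedge_rows (0 : 'M[R]_(p, n)))).
by apply: simpleZ => //; apply/simple_rows; exists 0.
Qed.

Lemma simple_basis (I : {set 'I_n}) : (0 < #|I|)%N -> simple #|I| (ext_basis R I).
Proof.
have [p] := ubnP #|I|; elim: p I => // p IH I; rewrite ltnS => lep I0.
have [i Ii] := card_gt0P I0; rewrite (ext_basisD1 R Ii); apply: simpleZ => //.
rewrite (cardsD1 i) Ii; apply: simple_vec_wedge.
have [I1|/IH] := posnP #|I :\ i|; last first.
  by apply; apply: leq_trans lep; rewrite [leqRHS](cardsD1 i) Ii.
rewrite I1 (cards0_eq I1) -(wedge_rows0 (0 : 'M[R]_(0, n))).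
by apply/simple_rows; exists 0.
Qed.

(** The supremum is bounded by the Euclidean norm of [phi], by Cauchy-Schwarz. *)
Lemma pairing_le_comass p phi xi :
  simple p xi -> enorm xi <= 1 -> pairing phi xi <= comass p phi.
Proof.
move=> sxi xi1; apply: ub_le_sup; last by exists xi.
exists (enorm phi) => _ [x [_ x1] <-].
apply: le_trans (ler_norm _) (le_trans (normr_pairing _ _) _).
by rewrite ler_piMr ?enorm_ge0.
Qed.

Lemma comass_le p phi (M : R) : (0 < p)%N ->
  (forall xi, simple p xi -> enorm xi <= 1 -> pairing phi xi <= M) -> comass p phi <= M.
Proof.
move=> p0 phiM; apply: ge_sup => [|_ [xi [sxi xi1] <-]]; last exact: phiM.
by exists (pairing phi 0), 0 => //; split; [apply: simple0 | rewrite enorm0].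
Qed.

Lemma comass_ge0 p phi : (0 < p)%N -> 0 <= comass p phi.
Proof.
move=> p0; rewrite -(pairing0r phi).
by apply: pairing_le_comass; [apply: simple0 | rewrite enorm0].
Qed.

(** A coefficient is a value on a basis element, which is simple of norm 1; its
    opposite is the value on the opposite, which is simple too. *)
Lemma coef_le_comass p phi (I : {set 'I_n}) : (0 < p)%N -> Lambda p phi ->
  `|phi I| <= comass p phi.
Proof.
move=> p0 pphi; have [pI|neI] := eqVneq #|I| p; last first.
  by rewrite pphi // normr0 comass_ge0.
have sI : simple p (ext_basis R I) by rewrite -pI; apply: simple_basis; rewrite pI.
rewrite ler_norml lerNl; apply/andP; split.
  rewrite -pairing_basisr -pairingNr -scaleN1r.
  apply: pairing_le_comass; first exact: simpleZ.
  by rewrite enormZ enorm_basis normrN1 mulr1.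
by rewrite -pairing_basisr; apply: pairing_le_comass; rewrite ?enorm_basis.
Qed.

(** A crude bound, whose purpose is to show that the set defining [Ccst] is
    bounded above and that the comass of a nonzero form is positive. *)
Lemma enorm_le_comass p phi : (0 < p)%N -> Lambda p phi ->
  enorm phi <= Num.sqrt #|{set 'I_n}|%:R * comass p phi.
Proof.
move=> p0 pphi; rewrite -[X in _ * X]ger0_norm ?comass_ge0 //.
rewrite -sqrtr_sqr -sqrtrM ?ler0n //.
apply: ler_wsqrtr; rewrite mulr_natl -sumr_const; apply: ler_sum => I _.
by rewrite -real_normK ?num_real // lerXn2r ?nnegrE ?comass_ge0 // coef_le_comass.
Qed.

Lemma enorm_le_Ccst p phi : (0 < p)%N -> Lambda p phi ->
  enorm phi <= Ccst R n p * comass p phi.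
Proof.
move=> p0 pphi; have [->|phi0] := eqVneq phi 0.
  rewrite (_ : comass p 0 = 0) ?mulr0; first by rewrite le_eqVlt enorm_eq0 eqxx.
  apply/le_anti/andP; split; last exact: comass_ge0.
  by apply: comass_le => // xi _ _; rewrite pairingC pairing0r.
have cm_gt0 (psi : ext R n) : Lambda p psi -> psi != 0 -> 0 < comass p psi.
  move=> ppsi psi0; rewrite lt0r comass_ge0 // andbT; apply: contraNneq psi0 => cm0.
  have := enorm_le_comass p0 ppsi.
  by rewrite cm0 mulr0 le_eqVlt enorm_eq0 ltNge enorm_ge0 orbF.
rewrite -ler_pdivrMr ?cm_gt0 //; apply: ub_le_sup; last by exists phi.
exists (Num.sqrt #|{set 'I_n}|%:R) => _ [psi [ppsi psi0] <-].
by rewrite ler_pdivrMr ?cm_gt0 // enorm_le_comass.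
Qed.

Lemma simple_orthonormal p xi : (p <= n)%N -> simple p xi -> enorm xi <= 1 ->
  exists U : 'M[R]_(p, n), exists c,
    [/\ U *m U^T = 1%:M, xi = c *: wedge_rows U & `|c| <= 1].
Proof.
move=> lepn /simple_rows[V ->]; have [U UU [c ->]] := Gram_Schmidt V lepn.
by rewrite enormZ enorm_rows // mulr1 => c1; exists U, c.
Qed.

End Comass.

(** Let [U] be the orthonormal frame of the simple vector and [W] a frame of its
    orthogonal complement.  The value of [hodge psi] on the wedge of [U] is the
    top coefficient of that wedge times [psi], hence up to sign its inner product
    with the wedge of [U] and [W] together; cancelling [U] isometrically leaves
    the value of [psi] on [W]. *)
Lemma comass_hodge (R : realType) p r (psi : ext R (p + r)) : (0 < p)%N -> (0 < r)%N ->
  comass p (hodge psi) <= comass r psi.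
Proof.
move=> p0 r0; apply: comass_le => // xi sxi xi1.
have [U [c [UU -> c1]]] := simple_orthonormal (leq_addr r p) sxi xi1.
have [W WW UW] := orthonormal_complement (leqnn _) UU.
(* [t] is a top form of norm 1, so it is the volume form up to the sign [d]. *)
pose t := wedge (wedge_rows U) (wedge_rows W); pose d := t finset.setT.
have tE : t = d *: ext_basis R finset.setT.
  by apply: Lambda_top; rewrite /t -wedge_rows_col_mx; apply: wedge_rows_Lambda.
have d1 : `|d| = 1.
  have := enorm_rows (orthonormal_col_mx UU WW UW).
  by rewrite wedge_rows_col_mx -/t tE enormZ enorm_basis mulr1.
have eT : ext_basis R finset.setT = d *: t :> ext R (p + r).
  by rewrite tE scalerA -expr2 -real_normK ?num_real // d1 expr1n scale1r.
have -> : pairing (hodge psi) (c *: wedge_rows U) =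
          pairing psi ((c * d) *: wedge_rows W).
  rewrite pairingC pairing_hodge -pairing_basisr eT wedgeZl pairingZl !pairingZr mulrA.
  congr (_ * _); rewrite pairing_orthonormal // => i.
  rewrite -[wedge_rows W]wedge1r contract_rows ?contract1 //.
  by rewrite -row_mul UW row0.
apply: pairing_le_comass; first by apply: simpleZ => //; apply/simple_rows; exists W.
by rewrite enormZ enorm_rows // mulr1 normrM d1 mulr1.
Qed.

(** The restriction of a form to a subspace has no larger comass: an isometric
    embedding takes simple vectors to simple vectors of the same norm. *)
Lemma comass_induced (R : realType) q n p (U : 'M[R]_(q, n)) (phi : ext R n) :
  (0 < p)%N -> U *m U^T = 1%:M -> comass p (induced U^T phi) <= comass p phi.
Proof.
move=> p0 UU; apply: comass_le => // xi /simple_rows[V ->] V1.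
rewrite pairing_induced trmxK; apply: pairing_le_comass.
  by apply/simple_rows; exists (V *m U); rewrite !wedge_rows_induced induced_comp.
by rewrite enormE pairing_induced induced_comp UU induced_id -enormE.
Qed.

(** It suffices to evaluate on orthonormal [q]-frames, that is, to restrict to
    subspaces of dimension [q]; restriction commutes with products and does not
    increase the comass of the factors.  This reduces a bound on the comass of a
    product in dimension [n] to a bound on norms in dimension [q]. *)
Lemma comass_wedges_le (R : realType) m q n p (phi : 'I_m -> ext R n) (M : R) :
  (0 < p)%N -> (0 < q)%N -> (q <= n)%N ->  0 <= M -> (forall i, Lambda p (phi i)) ->
  (forall chi : 'I_m -> ext R q, (forall i, Lambda p (chi i)) ->
    enorm (wedges chi) <= M * \prod_(i < m) comass p (chi i)) ->
  comass q (wedges phi) <= M * \prod_(i < m) comass p (phi i).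
Proof.
move=> p0 q0 leqn M0 pphi chiM; apply: comass_le => // xi sxi xi1.
have [U [c [UU -> c1]]] := simple_orthonormal leqn sxi xi1.
rewrite wedge_rows_induced -[U]trmxK -(linearZ_LR (induced U^T^T)).
rewrite -pairing_induced induced_wedges.
apply: le_trans (ler_norm _) (le_trans (normr_pairing _ _) _).
rewrite enormZ enorm_basis mulr1.
apply: le_trans (_ : _ <= enorm (wedges (fun i => induced U^T (phi i)))) _.
  by rewrite ler_piMr // enorm_ge0.
apply: le_trans (chiM _ _) _ => [i|]; first exact: induced_Lambda.
apply: ler_wpM2l => //; apply: ler_prod => i _.
by rewrite comass_ge0 // comass_induced.
Qed.

(** * The bound for a product *)

Theorem proposition4p3 (R : realType) (m p : nat) (hm : (1 <= m)%N)
    (hp : (1 <= p)%N) (phi : 'I_m -> ext R (m * p))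
    (hphi : forall i : 'I_m, Lambda p (phi i)) :
  enorm (wedges phi) <=
    (\prod_(2 <= j < m.+1) Ccst R (j * p) p ^+ 2) *
    \prod_(i < m) comass p (phi i).
Proof.
case: m hm phi hphi => // m _; elim: m => [|m IH] phi hphi.
  (* One factor: a top form has a single coefficient, a value on a simple
     vector. *)
  rewrite big_geq // mul1r big_ord1 /wedges big_ord1.
  have top : Lambda (1 * p) (phi ord0).
    by move=> I; rewrite [X in _ != X]mul1n; apply: hphi.
  by rewrite enorm_top //; apply: coef_le_comass.
pose r := (m.+1 * p)%N; have r0 : (0 < r)%N by rewrite muln_gt0.
pose psi : ext R (p + r) := wedges (fun i => phi (lift ord0 i)).
have rpsi : Lambda r psi by apply: wedges_Lambda.
have -> : wedges phi = wedge (phi ord0) psi by rewrite /wedges big_ord_recl.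
have top : Lambda (p + r) (wedge (phi ord0) psi) by apply: wedge_Lambda.
rewrite enorm_top // -pairing_hodge; apply: le_trans (normr_pairing _ _) _.
rewrite big_nat_recr //= [X in _ <= _ * X]big_ord_recl /=.
set C := Ccst _ _ _; set M := \prod_(2 <= _ < _) _.
have M0 : 0 <= M by apply: prodr_ge0 => j _; apply: sqr_ge0.
have psiM : comass r psi <= M * \prod_(i < m.+1) comass p (phi (lift ord0 i)).
  by apply: comass_wedges_le => //; rewrite leq_addl.
apply: le_trans (ler_pM (enorm_ge0 _) (enorm_ge0 _) (enorm_le_Ccst hp (hphi ord0))
  (enorm_le_Ccst hp (hodge_Lambda rpsi))) _.
rewrite -/C mulrACA -expr2 (mulrC M) -[X in _ <= X]mulrA (mulrCA M).
apply: ler_wpM2l; first exact: sqr_ge0.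
apply: ler_wpM2l; first exact: comass_ge0.
exact: le_trans (comass_hodge psi hp r0) psiM.
Qed.
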